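(* Let $I$ be an arbitrary set and let $\mathcal{P}=\mathcal{P}(I)$ be its power set, ordered by inclusion. Then there is an embedding of the poset $(\mathcal{P},\subseteq)$ into the lattice $(\mathcal{C},\leq)$ of all cotorsion theories of abelian groups, i.e. an injective map $\Psi:\mathcal{P}\to\mathcal{C}$ such that for all $X,Y\subseteq I$ we have $X\subseteq Y$ if and only if $\Psi(X)\leq\Psi(Y)$.
   Context: All groups are abelian groups. A cotorsion theory is a pair $(\mathcal{F},\mathcal{C})$ of classes of abelian groups which are maximal with respect to the property that $\mathrm{Ext}(F,C)=0$ for all $F\in\mathcal{F}$, $C\in\mathcal{C}$; equivalently $\mathcal{C}=\{X\mid \mathrm{Ext}(F,X)=0\ \forall F\in\mathcal{F}\}$ and $\mathcal{F}=\{Y\mid \mathrm{Ext}(Y,C)=0\ \forall C\in\mathcal{C}\}$. Cotorsion theories are ordered by $(\mathcal{F},\mathcal{C})\leq(\mathcal{F}',\mathcal{C}')$ iff $\mathcal{C}\subseteq\mathcal{C}'$ (equivalently $\mathcal{F}\supseteq\mathcal{F}'$); with infimum $\bigwedge_i(\mathcal{F}_i,\mathcal{C}_i)=({}^\perp(\bigcap_i\mathcal{C}_i),\bigcap_i\mathcal{C}_i)$ and supremum $\bigvee_i(\mathcal{F}_i,\mathcal{C}_i)=(\bigcap_i\mathcal{F}_i,(\bigcap_i\mathcal{F}_i)^\perp)$ this forms a lattice, where for a class $\mathcal{A}$, $\mathcal{A}^\perp=\{X\mid \mathrm{Ext}(A,X)=0\ \forall A\in\mathcal{A}\}$ and ${}^\perp\mathcal{A}=\{Y\mid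 \mathrm{Ext}(Y,A)=0\ \forall A\in\mathcal{A}\}$. *)

(* Defs.v *)
From HB Require Import structures.
From mathcomp Require Import all_boot all_algebra.
From mathcomp Require Import boolp classical_sets.

Set Implicit Arguments.
Unset Strict Implicit.
Unset Printing Implicit Defensive.

Import GRing.Theory.
Local Open Scope ring_scope.

(* A short exact sequence 0 -> C -> E -> F -> 0. *)
Record extension (F C : zmodType) : Type := Extension {
  ext_mid : zmodType;
  ext_in : {additive C -> ext_mid};
  ext_out : {additive ext_mid -> F};
  ext_in_inj : injective ext_in;
  ext_out_surj : forall y, exists x, ext_out x = y;
  ext_exact : forall x, ext_out x = 0 <-> exists c, ext_in c = x
}.

(* Such an f is automatically bijective: see ext_equiv_bij. *)
Definition ext_equiv (F C : zmodType) (E E' : extension F C) : Prop :=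
  exists f : {additive ext_mid E -> ext_mid E'},
    (forall c, f (ext_in E c) = ext_in E' c) /\
    (forall x, ext_out E' (f x) = ext_out E x).

Section SplitExtension.
Variables F C : zmodType.

Definition split_in (c : C) : C * F := (c, 0).
Definition split_out (x : C * F) : F := x.2.

Lemma split_in_additive : zmod_morphism split_in.
Proof. by move=> x y; congr pair; rewrite subr0. Qed.

Lemma split_out_additive : zmod_morphism split_out.
Proof. by []. Qed.

HB.instance Definition _ :=
  GRing.isZmodMorphism.Build C (C * F)%type split_in split_in_additive.
HB.instance Definition _ :=
  GRing.isZmodMorphism.Build (C * F)%type F split_out split_out_additive.

Lemma split_in_inj : injective split_in.
Proof. by move=> x y []. Qed.

Lemma split_out_surj : forall y, exists x, split_out x = y.
Proof. by move=> y; exists (0, y). Qed.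

Lemma split_exact x : split_out x = 0 <-> exists c, split_in c = x.
Proof.
case: x => c y; split; first by rewrite /split_out /= => ->; exists c.
by case=> d [_ <-].
Qed.

Definition split_extension : extension F C :=
  @Extension F C (C * F)%type split_in split_out
    split_in_inj split_out_surj split_exact.

End SplitExtension.

Lemma ext_equiv_bij (F C : zmodType) (E E' : extension F C)
    (f : {additive ext_mid E -> ext_mid E'}) :
  (forall c, f (ext_in E c) = ext_in E' c) ->
  (forall x, ext_out E' (f x) = ext_out E x) -> bijective f.
Proof.
move=> fin fout.
have finj : injective f.
  move=> x y fxy; apply/eqP; rewrite -subr_eq0; apply/eqP.
  have fz : f (x - y) = 0 by rewrite raddfB fxy subrr.
  have /ext_exact[c cE] : ext_out E (x - y) = 0 by rewrite -fout fz raddf0.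
  rewrite -cE; suff -> : c = 0 by rewrite raddf0.
  by apply: (@ext_in_inj _ _ E'); rewrite -fin cE fz raddf0.
have fsurj y : exists x, f x = y.
  have [x xE] := ext_out_surj E (ext_out E' y).
  have /ext_exact[c cE] : ext_out E' (y - f x) = 0.
    by rewrite raddfB fout xE subrr.
  by exists (x + ext_in E c); rewrite raddfD fin cE addrC subrK.
have [g gE] := choice fsurj.
by exists g => // x; apply: finj; rewrite gE.
Qed.

Lemma ext_equiv_refl (F C : zmodType) (E : extension F C) : ext_equiv E E.
Proof. by exists idfun. Qed.

Lemma ext_equiv_sym (F C : zmodType) (E E' : extension F C) :
  ext_equiv E E' -> ext_equiv E' E.
Proof.
case=> f [fin fout]; have [g fK gK] := ext_equiv_bij fin fout.
have gadd : zmod_morphism g by exact: can2_zmod_morphism fK gK.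
pose gA := GRing.isZmodMorphism.Build _ _ g gadd.
pose ga : {additive ext_mid E' -> ext_mid E} := HB.pack g gA.
exists ga; split=> [c|x] /=; first by rewrite -fin fK.
by rewrite -fout gK.
Qed.

Lemma ext_equiv_trans (F C : zmodType) (E1 E2 E3 : extension F C) :
  ext_equiv E1 E2 -> ext_equiv E2 E3 -> ext_equiv E1 E3.
Proof.
case=> f [fin fout] [g [gin gout]]; exists (g \o f : {additive _ -> _}).
by split=> [c|x] /=; rewrite ?fin ?gin ?gout ?fout.
Qed.

(* Ext(F, C) as the collection of equivalence classes of extensions of F by C.
   It is kept as a bare type rather than a zmodType (its universe lies above
   the one of zmodType); only its zero, which is the class of the split
   extension, is needed to say that it vanishes. *)
Record Ext (F C : zmodType) : Type := ExtClass {
  ext_class : extension F C -> Prop;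
  ext_classP : exists E, ext_class = ext_equiv E
}.

Definition Ext_of (F C : zmodType) (E : extension F C) : Ext F C :=
  ExtClass (ex_intro (fun E' => ext_equiv E = ext_equiv E') E erefl).

Definition Ext_zero (F C : zmodType) : Ext F C :=
  Ext_of (split_extension F C).

Definition Ext_vanishes (F C : zmodType) : Prop :=
  forall x : Ext F C, x = Ext_zero F C.

Lemma Ext_ofP (F C : zmodType) (E E' : extension F C) :
  Ext_of E = Ext_of E' <-> ext_equiv E E'.
Proof.
split=> [/(congr1 (@ext_class F C))/= ->|EE']; first exact: ext_equiv_refl.
have eqc : ext_equiv E = ext_equiv E'.
  apply/funext => D; apply/propext; split; last exact: ext_equiv_trans.
  by apply: ext_equiv_trans; apply: ext_equiv_sym.
rewrite /Ext_of; move: (ex_intro _ _ _) (ex_intro _ _ _); rewrite eqc => p q.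
by rewrite (Prop_irrelevance p q).
Qed.

Lemma Ext_vanishesP (F C : zmodType) :
  Ext_vanishes F C <->
  forall E : extension F C, ext_equiv E (split_extension F C).
Proof.
split=> [H E|H [X [E XE]]]; first by apply/Ext_ofP; apply: H.
rewrite /Ext_zero; have /Ext_ofP <- := H E; subst X.
by rewrite /Ext_of; congr ExtClass; apply: Prop_irrelevance.
Qed.

(* Not `set zmodType`: this keeps the universe of zmodType independent of the
   ones of the library's sets. *)
Definition group_class : Type := zmodType -> Prop.

Definition perp_right (A : group_class) : group_class :=
  fun X => forall F : zmodType, A F -> Ext_vanishes F X.

Definition perp_left (A : group_class) : group_class :=
  fun Y => forall C : zmodType, A C -> Ext_vanishes Y C.

Record cotorsion_theory : Type := CotorsionTheory {
  ct_left : group_class;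
  ct_right : group_class;
  ct_rightP : forall X : zmodType, ct_right X <-> perp_right ct_left X;
  ct_leftP : forall Y : zmodType, ct_left Y <-> perp_left ct_right Y
}.

Definition ct_le (T T' : cotorsion_theory) : Prop :=
  forall X : zmodType, ct_right T X -> ct_right T' X.

Lemma ct_le_left (T T' : cotorsion_theory) :
  ct_le T T' <-> forall Y : zmodType, ct_left T' Y -> ct_left T Y.
Proof.
split=> H G.
  by move=> /ct_leftP GT; apply/ct_leftP => C TC; apply/GT/H.
by move=> /ct_rightP GT; apply/ct_rightP => C TC; apply/GT/H.
Qed.

Lemma ct_le_anti (T T' : cotorsion_theory) :
  ct_le T T' -> ct_le T' T -> T = T'.
Proof.
move=> le1 le2; have [l1 l2] := (iffLR (ct_le_left _ _) le1,
                                 iffLR (ct_le_left _ _) le2).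
have eqR : ct_right T = ct_right T'.
  by apply/funext => X; apply/propext; split; [apply: le1|apply: le2].
have eqL : ct_left T = ct_left T'.
  by apply/funext => X; apply/propext; split; [apply: l2|apply: l1].
case: T T' {le1 le2 l1 l2} eqR eqL => [L R p q] [L' R' p' q'] /= eR eL.
by subst; congr CotorsionTheory; apply: Prop_irrelevance.
Qed.

Definition ext_orthogonal (A B : group_class) : Prop :=
  forall F C : zmodType, A F -> B C -> Ext_vanishes F C.

(* The defining equations of a cotorsion theory amount to its maximality among
   the Ext-orthogonal pairs of classes. *)
Lemma cotorsion_maximalP (A B : group_class) :
  ((forall X : zmodType, B X <-> perp_right A X) /\
   (forall Y : zmodType, A Y <-> perp_left B Y)) <->
  (ext_orthogonal A B /\
   forall A' B' : group_class, ext_orthogonal A' B' ->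
     (forall X : zmodType, A X -> A' X) -> (forall X : zmodType, B X -> B' X) ->
     (forall X : zmodType, A' X -> A X) /\ (forall X : zmodType, B' X -> B X)).
Proof.
split=> [[BE AE]|[AB maxAB]].
  split=> [F C AF /BE|A' B' AB' sA sB]; first exact.
  split=> X X'; first by apply/AE => C BC; apply: AB' => //; apply: sB.
  by apply/BE => F AF; apply: AB' => //; apply: sA.
split=> G; split=> [GA|GP].
- by move=> F AF; apply: AB.
- have [] := maxAB A (perp_right A) => //.
  + by move=> F C AF; apply.
  + by move=> X BX F AF; apply: AB.
  + by move=> _; apply.
- by move=> C BC; apply: AB.
- have [] := maxAB (perp_left B) B => //.
  + by move=> F C FP; apply: FP.
  + by move=> X AX C BC; apply: AB.
  + by move=> + _; apply.
Qed.

(* Main.v *)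
Require Import Defs.
From HB Require Import structures.
From mathcomp Require Import all_boot all_algebra.
From mathcomp Require Import boolp classical_sets functions wochoice.
From mathcomp Require Import zify.
Local Open Scope classical_set_scope.

Set Implicit Arguments.
Unset Strict Implicit.
Unset Printing Implicit Defensive.

Import GRing.Theory.

(* It suffices to find groups F_i and C_i (i in I) with Ext(F_i, C_j) = 0
   exactly when i <> j: then Psi(X) is the theory generated by the F_i with i
   outside X, and C_i lies in its right class exactly when i lies in X.

   Let K be the successor cardinal of a set of functions nat -> nat + I; its
   limits of cofinality omega split into disjoint stationary sets S_i. Fix a
   ladder b_d : nat -> K for each such limit d. F_i is generated by x_s (s a
   finite sequence in K) and y_{d,n} (d in S_i) with the relations
     2 y_{d,n+1} = y_{d,n} + x_{b_d|n},
   so Ext(F_i, C) = 0 means that the inhomogeneous systems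
     2 y_{d,n+1} - y_{d,n} - x_{b_d|n} = c_{d,n}
   over S_i all have solutions in C.

   C_j is generated freely by elements e_{d,n} and, recursively, by a formal
   solution of every system over the union of the S_i with i <> j. The system
   with right-hand side e over S_j has no solution in C_j: by stationarity some
   d in S_j has a ladder along which the putative x_s only involve data below d.
   Identities in C_j are finitary, so only countably many relations matter, and
   a countable set of ladders other than b_d can be disentangled; hence one can
   evaluate in Z so that everything below d becomes 0 while e_{d,n} becomes 1
   for even n and 0 for odd n. This would make 2 y_{n+1} - y_n = 1, 0, 1, 0, ...
   solvable in Z, but it forces 3 y_0 = 1. *)

(** * Hartogs well-orders and disjoint stationary sets *)

(** Decoding lets such functions cover [nat], [I] and their own finite sequences, which takes the
    place of cardinal arithmetic. *)
Definition code (I : Type) : Type := nat -> nat + I.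

Definition decode_nat I (m : code I) : nat := if m 0 is inl n then n else 0.

Definition decode_seq I (m : code I) : seq (code I) :=
  mkseq (fun i j => m (pickle (i, j)).+1) (decode_nat m).

Lemma decode_nat_surj I n : exists m : code I, decode_nat m = n.
Proof. by exists (fun=> inl n). Qed.

Lemma decode_seq_surj I (s : seq (code I)) : exists m, decode_seq m = s.
Proof.
pose d : code I := fun=> inl 0.
pose m k : nat + I := if k is k'.+1 then
    if unpickle k' is Some (i, j) then nth d s i j else inl 0
  else inl (size s).
exists m; rewrite /decode_seq /=; under eq_mkseq => i.
  rewrite (_ : (fun j => _) = nth d s i); last first.
    by apply/funext => j; rewrite /m pickleK.
  over.
exact: mkseq_nth.
Qed.

Section WellOrder.
Variables (W : eqType) (R : rel W).
Hypothesis Rwo : well_order R.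

Lemma wo_total : total R.
Proof.
have := @wo_chainW W R predT (fun A _ => @Rwo A).
by move=> H x y; apply: H.
Qed.

Lemma wo_anti : antisymmetric R.
Proof.
have := @wo_chain_antisymmetric W R predT (fun A _ => @Rwo A).
by move=> H x y; apply: H.
Qed.

Lemma wo_trans : transitive R.
Proof.
move=> y x z xy yz.
have [|m [[mA mle] _]] := Rwo (A := [pred u | [|| u == x, u == y | u == z]]).
  by exists x; rewrite inE eqxx.
have [mx my mz] : [/\ R m x, R m y & R m z].
  by split; apply: mle; rewrite inE eqxx ?orbT.
move: mA; rewrite inE => /or3P[] /eqP mE; subst m => //.
- by have -> : x = y by apply: wo_anti; rewrite xy.
- by have <- : y = z by apply: wo_anti; rewrite yz.
Qed.

Lemma wo_least (A : W -> Prop) :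
  (exists w, A w) -> exists2 w, A w & forall v, A v -> R w v.
Proof.
move=> [w Aw]; have [|m [[mA mle] _]] := Rwo (A := [pred u | `[< A u >]]).
  by exists w; apply/asboolP.
exists m; first by move: mA => /asboolP.
by move=> v Av; apply: mle; apply/asboolP.
Qed.

End WellOrder.

(* A well-order of type |X|^+, phrased with surjections so that no injection
   ever has to be constructed. *)
Record hartogs (X : Type) := Hartogs {
  ht_sort :> eqType;
  ht_le : rel ht_sort;
  ht_wo : well_order ht_le;
  ht_pt : ht_sort;
  ht_seg : forall w : ht_sort, exists e : X -> ht_sort,
    forall v, ht_le v w -> exists x, e x = v;
  ht_not_image : forall e : X -> ht_sort, exists v, forall x, e x <> v
}.

(** Well-order the subsets of [X] and keep the points whose closed segment is an image of [X]. No
    image of [X] exhausts them: if every point is kept, this is Cantor's diagonal; otherwise the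
    least omitted point would qualify, [p] making room for one extra value. *)
Lemma hartogs_exists (X : Type) (p : X -> option X) :
  (forall o, exists x, p x = o) -> inhabited (hartogs X).
Proof.
move=> psurj; have [x0 _] := psurj None.
pose W : eqType := {classic (set X)}; have [R Rwo] := well_ordering_principle W.
have anti := wo_anti Rwo.
pose P (w : W) := `[< exists e : X -> W, forall v, R v w -> exists x, e x = v >].
have [w0 _ w0min] := wo_least Rwo (ex_intro (fun=> True) (set0 : set X) I).
have Pw0 : P w0.
  apply/asboolP; exists (fun=> w0) => v vw; exists x0.
  by apply: anti; rewrite vw w0min.
pose K := {w : W | P w}; pose leK : rel K := fun u v => R (val u) (val v).
have Kwo : well_order leK.
  move=> A [w Aw].
  have [|m [k Ak km] mmin] :=
    wo_least Rwo (A := fun u => exists2 k : K, k \in A & val k = u).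
    by exists (val w), w.
  exists k; split.
    by split=> // j Aj; rewrite /leK km; apply: mmin; exists j.
  move=> j [Aj jmin]; apply: val_inj; apply: anti.
  by rewrite km mmin ?andbT; [rewrite -km; apply: jmin | exists j].
constructor; apply: (@Hartogs X K leK Kwo (exist _ w0 Pw0)).
- move=> w; have /asboolP[e eE] := valP w; exists (fun x => insubd w (e x)) => v.
  by move=> /eE[x xE]; exists x; rewrite xE valKd.
- move=> e; apply: contrapT => /forallNP eN.
  have {}eN v : exists x, e x = v.
    by apply: contrapT => /forallNP vN; apply: (eN v) => x; apply: vN.
  have [allP|] := pselect (forall w, P w).
    pose D : set X := fun x => ~ (val (e x) : set X) x.
    have [x xE] := eN (exist _ (D : W) (allP D)).
    have /= : (val (e x) : set X) x <-> D x by rewrite xE.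
    by rewrite /D /=; tauto.
  move=> /existsNP/(wo_least Rwo)[w /negP NPw wmin].
  case/negP: NPw; apply/asboolP.
  exists (fun x => if p x is Some y then val (e y) else w) => v vw.
  have [Pv|/negP/wmin wv] := boolP (P v); last first.
    by have [x xE] := psurj None; exists x; rewrite xE; apply: anti; rewrite wv.
  have [y yE] := eN (exist _ v Pv); have [x xE] := psurj (Some y).
  by exists x; rewrite xE yE.
Qed.

Definition ladder (K : eqType) (lt : rel K) (d : K) (b : nat -> K) :=
  (forall n, lt (b n) d) /\ (forall v, lt v d -> exists n, ~~ lt (b n) v).

Definition closed_under (K : eqType) (lt : rel K) (h : nat -> seq K -> K) d :=
  forall k s, all (lt^~ d) s -> lt (h k s) d.

Definition stationary (K : eqType) (lt : rel K) (S : K -> Prop) :=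
  forall h, exists2 d, S d & closed_under lt h d.

Section Stationary.
Variables (I : Type) (K : hartogs (code I)).
Local Notation le := (@ht_le _ K).
Definition ht_lt : rel K := fun u v => ~~ le v u.
Local Notation lt := ht_lt.

Let le_total := wo_total (@ht_wo _ K).
Let le_trans := wo_trans (@ht_wo _ K).
Let le_anti := wo_anti (@ht_wo _ K).

Lemma ht_le_refl u : le u u.
Proof. by have := le_total u u; rewrite orbb. Qed.

Lemma ht_ltW u v : lt u v -> le u v.
Proof. by rewrite /ht_lt => /negPf uv; have := le_total v u; rewrite uv. Qed.

Lemma ht_lt_le_trans u v w : lt u v -> le v w -> lt u w.
Proof. by move=> + vw; apply: contra; apply: le_trans. Qed.

Lemma ht_lt_irr : irreflexive lt.
Proof. by move=> u; rewrite /ht_lt ht_le_refl. Qed.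

Lemma ht_lt_trans : transitive lt.
Proof. by move=> v u w uv /ht_ltW; apply: ht_lt_le_trans. Qed.

Lemma ht_lt_total u v : [|| lt u v, u == v | lt v u].
Proof.
rewrite /ht_lt; case uv: (le u v); rewrite ?orbT //; case vu: (le v u) => //=.
by rewrite orbF; apply/eqP/le_anti; rewrite uv.
Qed.

(** Otherwise [K] would be a union of segments indexed by codes, each an image of [code I]; as pairs
    of codes are coded again, this contradicts [ht_not_image]. *)
Lemma ht_bounded (f : code I -> K) : exists w, forall m, lt (f m) w.
Proof.
apply: contrapT => /forallNP fN.
have {}fN w : exists m, le w (f m).
  by have /existsNP[m /negP] := fN w; rewrite negbK; exists m.
have [e eE] := choice (@ht_seg _ K).
pose d (m : code I) := nth m (decode_seq m).
have [v vN] := ht_not_image (fun m => e (f (d m 0)) (d m 1)).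
have [m vm] := fN v; have [x xE] := eE _ _ vm.
have [c cE] := decode_seq_surj [:: m; x].
by apply: (vN c); rewrite /d cE.
Qed.

Lemma ht_bounded_seq (f : nat -> K) : exists w, forall n, lt (f n) w.
Proof.
have [w fw] := ht_bounded (fun m => f (decode_nat m)).
by exists w => n; have [m <-] := decode_nat_surj I n.
Qed.

Lemma ht_closure_step (h : nat -> seq K -> K) (w : K) :
  exists w', lt w w' /\ forall k s, all (le^~ w) s -> lt (h k s) w'.
Proof.
have [e eE] := ht_seg w.
pose f (m : code I) := if decode_seq m is k :: s then h (decode_nat k) (map e s)
                       else w.
have [w' fw'] := ht_bounded f; exists w'; split=> [|k s].
  have [m mE] := decode_seq_surj ([::] : seq (code I)).
  by have := fw' m; rewrite /f mE.
move=> sw; have [s' <-] : exists s', map e s' = s.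
  elim: s sw => [|u s IHs] /=; first by exists [::].
  by move=> /andP[/eE[x <-] /IHs[s' <-]]; exists (x :: s').
have [c cE] := decode_nat_surj I k; have [m mE] := decode_seq_surj (c :: s').
by have := fw' m; rewrite /f mE cE.
Qed.

(** Iterate the closure step. The least strict bound of the iterates has them as a ladder, and a
    finite sequence below it already lies below some iterate. *)
Lemma ht_closed_ladder (h : nat -> seq K -> K) (w : K) :
  exists d, [/\ lt w d, exists b, ladder lt d b & closed_under lt h d].
Proof.
have [g gE] := choice (ht_closure_step h).
pose u n := iter n g w.
have u_lt n : lt (u n) (u n.+1) by have [] := gE (u n).
have u_le m n : m <= n -> le (u m) (u n).
  elim: n => [|n IHn]; first by rewrite leqn0 => /eqP->; apply: ht_le_refl.
  rewrite leq_eqVlt => /predU1P[->|]; first exact: ht_le_refl.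
  by move=> /IHn /le_trans; apply; apply: ht_ltW.
have [d ud dmin] := wo_least (@ht_wo _ K) (ht_bounded_seq u).
have dlim v : lt v d -> exists n, ~~ lt (u n) v.
  move=> /negP vd; apply: contrapT => /forallNP uv; apply: vd.
  by apply: dmin => n; apply: contrapT => /negP/uv.
exists d; split; [exact: (ud 0) | by exists u | move=> k s sd].
have [n sn] : exists n, all (le^~ (u n)) s.
  elim: s sd => [|v s IHs] /=; first by exists 0.
  move=> /andP[/dlim[m] + /IHs[n sn]]; rewrite negbK => vm; exists (maxn m n).
  apply/andP; split; first by apply: le_trans vm _; rewrite u_le ?leq_maxl.
  by apply: sub_all sn => x xn; apply: le_trans xn _; rewrite u_le ?leq_maxr.
by apply: ht_lt_trans (ud n.+1); have [_] := gE (u n); apply.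
Qed.

Section Splitting.
Variable b : K -> nat -> K.
Hypothesis bP : forall d, (exists b', ladder lt d b') -> ladder lt d (b d).

Let U n v := stationary lt (fun d => ladder lt d (b d) /\ b d n = v).

(* Fodor's argument: otherwise diagonalising the witnesses of nonstationarity
   gives d all of whose ladder points lie below w. *)
Lemma ht_stationary_unbounded w : exists2 v, exists n, U n v & le w v.
Proof.
apply: contrapT => /forall2NP UN.
have {}UN nv : exists h, le w nv.2 ->
    forall d, ladder lt d (b d) -> b d nv.1 = nv.2 -> ~ closed_under lt h d.
  case: nv => n v /=; have [] := UN v; last by exists (fun _ _ => w).
  move=> /forallNP/(_ n) /existsNP[h /forall2NP hP]; exists h => _ d dl dn.
  by have [dN|//] := hP d; case: dN.
have [h hP] := choice UN.
(* The head of the sequence selects the witness, so closure of [d] under [H] gives closure under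
   [h (n, v)] for all [n] and all [v] below [d]. *)
pose H k s := if s is v :: s' then
    if unpickle k is Some (n, k') then h (n, v) k' s' else w else w.
have [d [wd /bP dl dH]] := ht_closed_ladder H w.
have [_ /(_ w wd)[n]] := dl; rewrite negbK => wn.
apply: (hP (n, b d n) wn d) => //= k s sd.
have := dH (pickle (n, k)) (b d n :: s); rewrite /H pickleK /=; apply.
by rewrite sd andbT; apply: dl.1.
Qed.

(** Otherwise an image of [code I] would cover [U n] for every [n], and the countable union of these
    images would be bounded, against [ht_stationary_unbounded]. *)
Lemma ht_stationary_fibres :
  exists n, forall e : code I -> K, exists2 v, U n v & forall m, e m <> v.
Proof.
apply: contrapT => /forallNP UN.
have {}UN n : exists e : code I -> K, forall v, U n v -> exists m, e m = v.
  have /existsNP[e /forall2NP eP] := UN n; exists e => v Unv.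
  by apply: contrapT => /forallNP eN; case: (eP v).
have [e eE] := choice UN.
pose d (m : code I) := nth m (decode_seq m).
have [w wP] := ht_bounded (fun m => e (decode_nat (d m 0)) (d m 1)).
have [v [n /eE[x xE]] wv] := ht_stationary_unbounded w.
have [c cE] := decode_nat_surj I n; have [m mE] := decode_seq_surj [:: c; x].
by have := wP m; rewrite /d mE /= cE xE /ht_lt wv.
Qed.
End Splitting.
End Stationary.

(** Well-order [J] and recursively pick a point of [U] outside the values chosen so far; [t0] fills
    the map at indices that are not earlier. *)
Lemma injection_of_no_surjection (T : Type) (J : Type) (U : T -> Prop) (t0 : T) :
  (forall e : J -> T, exists2 v, U v & forall j, e j <> v) ->
  exists2 g : J -> T, injective g & forall j, U (g j).
Proof.
move=> Unot.
have [R Rwo] := well_ordering_principle {classic J}.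
have [F FP] := choice (fun e => (exists2P _ _).1 (Unot e)).
have anti := wo_anti Rwo.
pose lt (i j : J) := ~~ R j i.
have wf : well_founded lt.
  move=> j; apply: contrapT => jN.
  have [k kN kmin] := wo_least Rwo (ex_intro (fun j => ~ Acc lt j) j jN).
  apply: kN; constructor => i ik; apply: contrapT => iN.
  by have /negP := ik; apply; apply: kmin.
pose step (j : J) (rec : forall i, lt i j -> T) : T :=
  F (fun i => if pselect (lt i j) is left ij then rec i ij else t0).
pose g := Fix wf (fun=> T) step.
have gE j : g j = F (fun i => if pselect (lt i j) is left ij then g i else t0).
  rewrite /g Fix_eq // => i f f' ff'; congr F; apply/funext => k.
  by case: pselect.
have g_lt i j : lt i j -> g i <> g j.
  move=> ij; rewrite (gE j); set e := (e in F e).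
  by have [_ /(_ i)] := FP e; rewrite /e; case: pselect.
exists g => [i j gij|j]; last by rewrite gE; apply: (FP _).1.
by apply: anti; apply/andP; split; apply/negPn/negP => /g_lt;
  rewrite gij.
Qed.

Lemma disjoint_stationary (I : Type) :
  exists (K : eqType) (x0 : K) (lt : rel K) (b : K -> nat -> K)
         (S : I -> K -> Prop),
  [/\ irreflexive lt, transitive lt, forall u v, [|| lt u v, u == v | lt v u] &
   [/\ forall i d, S i d -> ladder lt d (b d),
       forall i j d, S i d -> S j d -> i = j &
       forall i, stationary lt (S i)]].
Proof.
have [|K] := @hartogs_exists (code I) (fun m => ohead (decode_seq m)).
  move=> o; have [m mE] := decode_seq_surj (seq_of_opt o).
  by exists m; rewrite mE; case: o {mE}.
pose lt := @ht_lt _ K.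
have lad_choice d : exists b', (exists b, ladder lt d b) -> ladder lt d b'.
  have [[b bP]|] := pselect (exists b, ladder lt d b); first by exists b.
  by exists (fun=> d).
have [b bP] := choice lad_choice; have [n nP] := ht_stationary_fibres bP.
have [|g ginj gP] := @injection_of_no_surjection K I (fun v =>
    stationary lt (fun d => ladder lt d (b d) /\ b d n = v)) (ht_pt K).
  move=> e.
  (* The map [e] is extended to codes through their first value, so a point avoiding the extension
     avoids [e]. *)
  have [v Uv vP] := nP (fun m => if m 0 is inr i then e i else ht_pt K).
  by exists v => // i; apply: (vP (fun=> inr i)).
exists K, (ht_pt K), lt, b, (fun i d => ladder lt d (b d) /\ b d n = g i).
split; [exact: ht_lt_irr | exact: ht_lt_trans | exact: ht_lt_total | split].
- by move=> i d [].
- by move=> i j d [_ iE] [_ jE]; apply: ginj; rewrite -iE.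
- exact: gP.
Qed.

(** * The groups presented by ladder systems *)

Local Open Scope ring_scope.

Record pregroup := Pregroup {
  pg_sort :> Type;
  pg_zero : pg_sort;
  pg_opp : pg_sort -> pg_sort;
  pg_add : pg_sort -> pg_sort -> pg_sort;
  pg_eq : pg_sort -> pg_sort -> Prop;
  pg_refl : forall x, pg_eq x x;
  pg_sym : forall x y, pg_eq x y -> pg_eq y x;
  pg_trans : forall y x z, pg_eq x y -> pg_eq y z -> pg_eq x z;
  pg_eq_opp : forall x y, pg_eq x y -> pg_eq (pg_opp x) (pg_opp y);
  pg_eq_add : forall x y z t,
    pg_eq x y -> pg_eq z t -> pg_eq (pg_add x z) (pg_add y t);
  pg_addA : forall x y z, pg_eq (pg_add x (pg_add y z)) (pg_add (pg_add x y) z);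
  pg_addC : forall x y, pg_eq (pg_add x y) (pg_add y x);
  pg_add0 : forall x, pg_eq (pg_add pg_zero x) x;
  pg_addN : forall x, pg_eq (pg_add (pg_opp x) x) pg_zero
}.

Definition pg_quot (T : pregroup) := {A : T -> Prop | exists t, A = pg_eq t}.

Section PregroupQuotient.
Variable T : pregroup.
Implicit Types (t u : T) (x y z : pg_quot T).

Definition pg_class t : pg_quot T := exist _ (pg_eq t) (ex_intro _ t erefl).

Definition pg_repr x : T := sval (cid (svalP x)).

Lemma pg_quot_inj x y : sval x = sval y -> x = y.
Proof.
case: x y => [A p] [B q] /= AB; rewrite {}AB in p *.
by rewrite (Prop_irrelevance p q).
Qed.

Lemma pg_classP t u : pg_class t = pg_class u <-> pg_eq t u.
Proof.
split=> [/(congr1 sval)/= ->|tu]; first exact: pg_refl.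
apply: pg_quot_inj => /=; apply/funext => v; apply/propext.
by split; apply: pg_trans => //; apply: pg_sym.
Qed.

Lemma pg_reprK : cancel pg_repr pg_class.
Proof. by move=> x; apply: pg_quot_inj; rewrite /= /pg_repr; case: cid. Qed.

Lemma pg_repr_class t : pg_eq (pg_repr (pg_class t)) t.
Proof. by apply/pg_classP; rewrite pg_reprK. Qed.

HB.instance Definition _ := gen_eqMixin (pg_quot T).
HB.instance Definition _ := gen_choiceMixin (pg_quot T).

Definition quot_add x y := pg_class (pg_add (pg_repr x) (pg_repr y)).
Definition quot_opp x := pg_class (pg_opp (pg_repr x)).

Lemma quot_addE t u :
  quot_add (pg_class t) (pg_class u) = pg_class (pg_add t u).
Proof. by apply/pg_classP/pg_eq_add; apply: pg_repr_class. Qed.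

Lemma quot_addA : associative quot_add.
Proof.
move=> x y z; rewrite -[x]pg_reprK -[y]pg_reprK -[z]pg_reprK !quot_addE.
exact/pg_classP/pg_addA.
Qed.

Lemma quot_addC : commutative quot_add.
Proof. by move=> x y; apply/pg_classP/pg_addC. Qed.

Lemma quot_add0 : left_id (pg_class (pg_zero T)) quot_add.
Proof. by move=> x; rewrite -[x]pg_reprK quot_addE; apply/pg_classP/pg_add0. Qed.

Lemma quot_addN : left_inverse (pg_class (pg_zero T)) quot_opp quot_add.
Proof.
by move=> x; rewrite -{2}[x]pg_reprK quot_addE; apply/pg_classP/pg_addN.
Qed.

HB.instance Definition _ :=
  GRing.isZmodule.Build (pg_quot T) quot_addA quot_addC quot_add0 quot_addN.

Lemma pg_classD t u : pg_class (pg_add t u) = pg_class t + pg_class u.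
Proof. by rewrite -quot_addE. Qed.

Lemma pg_classN t : pg_class (pg_opp t) = - pg_class t.
Proof.
by apply/esym/pg_classP/pg_eq_opp/pg_repr_class.
Qed.

Section Lift.
Variables (M : zmodType) (f : T -> M).
Hypothesis f_eq : forall t u, pg_eq t u -> f t = f u.
Hypothesis fB : forall t u, f (pg_add t (pg_opp u)) = f t - f u.

Definition quot_lift x := f (pg_repr x).

Lemma quot_liftE t : quot_lift (pg_class t) = f t.
Proof. exact/f_eq/pg_repr_class. Qed.

Lemma quot_lift_additive : zmod_morphism quot_lift.
Proof.
move=> x y; rewrite -[x]pg_reprK -[y]pg_reprK -pg_classN -pg_classD.
by rewrite !quot_liftE fB.
Qed.

Lemma quot_lift_ex :
  exists g : {additive pg_quot T -> M}, forall t, g (pg_class t) = f t.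
Proof.
pose gA := GRing.isZmodMorphism.Build _ _ quot_lift quot_lift_additive.
pose g : {additive pg_quot T -> M} := HB.pack quot_lift gA.
by exists g => t; apply: quot_liftE.
Qed.
End Lift.

End PregroupQuotient.

Inductive term (G : Type) : Type :=
| TGen of G
| TZero
| TOpp of term G
| TAdd of term G & term G.

Fixpoint teval (G : Type) (M : zmodType) (v : G -> M) (t : term G) : M :=
  match t with
  | TGen g => v g
  | TZero => 0
  | TOpp t => - teval v t
  | TAdd t u => teval v t + teval v u
  end.

Lemma raddf_teval (M N : zmodType) (f : {additive M -> N}) G (v : G -> M) t :
  f (teval v t) = teval (f \o v) t.
Proof.
by elim: t => //= [|t <-|t <- u <-]; rewrite ?raddf0 ?raddfN ?raddfD.
Qed.

Lemma teval_fct (X : Type) (M : zmodType) (G : Type) (v : G -> X -> M) t x :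
  teval (M := X -> M) v t x = teval (v^~ x) t.
Proof. by elim: t => //= [t <-|t <- u <-]. Qed.

Definition subgroup (M : zmodType) (P : M -> Prop) :=
  P 0 /\ forall x y, P x -> P y -> P (x - y).

(** * Ladder groups: vanishing of Ext as solvability of systems *)

Section LadderGroup.
Variables (K : eqType) (b : K -> nat -> K).

(* [inl s] stands for x_s and [inr (d, n)] for y_{d,n}. *)
Definition lgen : Type := (seq K + K * nat)%type.

Definition relator (M : zmodType) (v : lgen -> M) (d : K) (n : nat) : M :=
  v (inr (d, n.+1)) *+ 2 - v (inr (d, n)) - v (inl (mkseq (b d) n)).

Definition relterm (d : K) (n : nat) : term lgen :=
  TAdd (TAdd (TAdd (TGen (inr (d, n.+1))) (TGen (inr (d, n.+1))))
             (TOpp (TGen (inr (d, n)))))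
       (TOpp (TGen (inl (mkseq (b d) n)))).

Lemma teval_relterm (M : zmodType) (v : lgen -> M) d n :
  teval v (relterm d n) = relator v d n.
Proof. by rewrite /relator mulr2n. Qed.

Variable A : K -> Prop.

Definition solvable_in (C : zmodType) :=
  forall c : K -> nat -> C, exists v : lgen -> C,
    forall d n, A d -> relator v d n = c d n.

(* Working modulo a subgroup [P] makes homomorphisms to quotients available
   without constructing them. *)
Definition lg_eq (t u : term lgen) : Prop :=
  forall (M : zmodType) (P : M -> Prop) (v : lgen -> M), subgroup P ->
    (forall d n, A d -> P (relator v d n)) -> P (teval v t - teval v u).

Lemma lg_eqW t u :
  (forall (M : zmodType) (v : lgen -> M), teval v t = teval v u) -> lg_eq t u.
Proof. by move=> tu M P v [P0 _] _; rewrite tu subrr. Qed.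

Lemma lg_eq_sym t u : lg_eq t u -> lg_eq u t.
Proof.
by move=> tu M P v PP Pv; rewrite -opprB -sub0r; apply: PP.2; [case: PP | apply: tu].
Qed.

Lemma lg_eq_opp t u : lg_eq t u -> lg_eq (TOpp t) (TOpp u).
Proof. by move=> /lg_eq_sym ut M P v PP Pv /=; rewrite opprK addrC; apply: ut. Qed.

Lemma lg_eq_add t u t' u' :
  lg_eq t u -> lg_eq t' u' -> lg_eq (TAdd t t') (TAdd u u').
Proof.
move=> tu /lg_eq_sym ut' M P v PP Pv /=.
rewrite opprD addrACA -[_ - teval v u']opprB.
by apply: PP.2; [apply: tu | apply: ut'].
Qed.

Lemma lg_eq_trans u t w : lg_eq t u -> lg_eq u w -> lg_eq t w.
Proof.
move=> tu /lg_eq_sym wu M P v PP Pv.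
rewrite -[_ - _](subrKA (teval v u)) -[teval v u - _]opprB.
by apply: PP.2; [apply: tu | apply: wu].
Qed.

Definition ladder_pregroup : pregroup.
Proof.
refine (@Pregroup (term lgen) (TZero _) (@TOpp _) (@TAdd _) lg_eq
  _ lg_eq_sym lg_eq_trans lg_eq_opp lg_eq_add _ _ _ _).
- by move=> x; apply: lg_eqW.
- by move=> x y z; apply: lg_eqW => M v /=; rewrite addrA.
- by move=> x y; apply: lg_eqW => M v /=; rewrite addrC.
- by move=> x; apply: lg_eqW => M v /=; rewrite add0r.
- by move=> x; apply: lg_eqW => M v /=; rewrite addNr.
Defined.

Definition ladder_group : zmodType := pg_quot ladder_pregroup.

Definition lclass (t : term lgen) : ladder_group := @pg_class ladder_pregroup t.

Lemma lclassP t u : lclass t = lclass u <-> lg_eq t u.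
Proof. exact: (@pg_classP ladder_pregroup). Qed.

Lemma lclass_eq0 t : lclass t = 0 <-> lg_eq t (TZero _).
Proof. exact: lclassP. Qed.

Lemma lclass_eval t : lclass t = teval (fun g => lclass (TGen g)) t.
Proof.
elim: t => //= [t <-|t <- u <-].
  by rewrite -[LHS]/(pg_class (@pg_opp ladder_pregroup t)) pg_classN.
by rewrite -[LHS]/(pg_class (@pg_add ladder_pregroup t u)) pg_classD.
Qed.

Lemma lg_eq_relterm d n : A d -> lg_eq (relterm d n) (TZero _).
Proof. by move=> Ad M P v _ Pv; rewrite teval_relterm subr0; apply: Pv. Qed.

Lemma ladder_group_hom (M : zmodType) (v : lgen -> M) :
  (forall d n, A d -> relator v d n = 0) ->
  exists g : {additive ladder_group -> M}, forall t, g (lclass t) = teval v t.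
Proof.
move=> vA; apply: (@quot_lift_ex ladder_pregroup M (teval v)) => // t u tu.
apply/eqP; rewrite -subr_eq0; apply/eqP.
apply: (tu M (fun x => x = 0)) => //; split=> // x y -> ->.
by rewrite subr0.
Qed.

Lemma raddf_relator (M N : zmodType) (f : {additive M -> N}) v d n :
  f (relator v d n) = relator (f \o v) d n.
Proof. by rewrite /relator !raddfB raddfMn. Qed.

Lemma relatorB (M : zmodType) (v w : lgen -> M) d n :
  relator (fun g => v g - w g) d n = relator v d n - relator w d n.
Proof.
rewrite /relator mulrnBl !opprD !opprK (addrACA _ _ (- v (inr (d, n)))).
by rewrite (addrACA _ _ (- v (inl _))).
 Qed.

Lemma relator_lclass d n : A d -> relator (fun g => lclass (TGen g)) d n = 0.
Proof.
move=> Ad; rewrite -teval_relterm -lclass_eval.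
by apply/lclass_eq0; apply: lg_eq_relterm.
Qed.

(** Lift the generators to the extension. The relators of the lifts land in [C], and a solution
    there corrects the lifts so that they define a section. *)
Lemma Ext_vanishes_of_solvable (C : zmodType) :
  solvable_in C -> Ext_vanishes ladder_group C.
Proof.
move=> solC; apply/Ext_vanishesP => E; apply: ext_equiv_sym.
have [v0 v0E] := choice (fun g => ext_out_surj E (lclass (TGen g))).
have v0rel d n : exists c, A d -> ext_in E c = relator v0 d n.
  have [Ad|] := pselect (A d); last by exists 0.
  have [|c cE] := (iffLR (ext_exact (relator v0 d n))); last by exists c.
  by rewrite raddf_relator (_ : _ \o _ = fun g => lclass (TGen g)) ?relator_lclass //;
    apply/funext.
have [c0 c0E] := choice (fun dn => v0rel dn.1 dn.2).
have [u uE] := solC (fun d n => c0 (d, n)).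
have [|s sE] := @ladder_group_hom _ (fun g => v0 g - ext_in E (u g)).
  move=> d n Ad; rewrite relatorB -(c0E (d, n) Ad) /= -uE // raddf_relator.
  exact: subrr.
pose f (x : C * ladder_group) : ext_mid E := ext_in E x.1 + s x.2.
have fadd : zmod_morphism f.
  by move=> x y; rewrite /f !raddfB /= addrACA opprD.
pose fA := GRing.isZmodMorphism.Build _ _ f fadd.
exists (HB.pack f fA : {additive _ -> _}); split=> [c|[c x]] /=.
  by rewrite /f /= raddf0 addr0.
rewrite /f raddfD /= (iffRL (ext_exact _)) ?add0r; last by exists c.
rewrite -[x](@pg_reprK ladder_pregroup) -[pg_class _]/(lclass _).
rewrite sE raddf_teval [RHS]lclass_eval; congr (teval _ _); apply/funext => g /=.
by rewrite raddfB v0E (iffRL (ext_exact _)) ?subr0 //; exists (u g).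
Qed.

Section TruncatedSolution.
Variables (C : zmodType) (c : K -> nat -> C).

(* With all x_s = 0 the system is solved by y_{d,n} = - sum_(m >= n) 2^(m-n) c_{d,m};
   truncated at N it satisfies the equations of index n < N. Sequences in N up to
   eventual equality thus form an overgroup of C in which the system is solvable. *)
Definition trunc_sol (N : nat) (g : lgen) : C :=
  match g with
  | inl _ => 0
  | inr (d, n) => - \sum_(n <= m < N) c d m *+ 2 ^ (m - n)
  end.

Lemma relator_trunc_sol N d n : (n < N)%N -> relator (trunc_sol N) d n = c d n.
Proof.
move=> nN; rewrite /relator /= subr0 opprK mulNrn [in X in _ + X]big_ltn //.
rewrite subnn expn0 mulr1n addrCA [X in _ + X](_ : _ = 0) ?addr0 //.
rewrite -sumrMnl addrC; apply/eqP; rewrite subr_eq0; apply/eqP.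
apply: eq_big_nat => m /andP[nm _].
by rewrite -mulrnA -expnSr subnSK.
Qed.

(** A pair [(a, t)] stands for the class of [t] together with the sequence
    [a + teval (trunc_sol N) t] modulo eventual equality, so the extension sits inside the product
    of the ladder group and the overgroup of [C]. *)
Definition lext_eq (x y : C * term lgen) : Prop :=
  lg_eq x.2 y.2 /\ exists N0, forall N, (N0 <= N)%N ->
    x.1 + teval (trunc_sol N) x.2 = y.1 + teval (trunc_sol N) y.2.

Definition lext_pregroup : pregroup.
Proof.
refine (@Pregroup (C * term lgen)%type (0, TZero _)
  (fun x => (- x.1, TOpp x.2)) (fun x y => (x.1 + y.1, TAdd x.2 y.2)) lext_eq
  _ _ _ _ _ _ _ _ _).
- by move=> x; split; [apply: lg_eqW | exists 0%N].
- by move=> x y [/lg_eq_sym xy [N xyN]]; split=> //; exists N => n /xyN.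
- move=> y x z [xy [N xyN]] [yz [N' yzN]]; split; first exact: lg_eq_trans xy yz.
  by exists (maxn N N') => n; rewrite geq_max => /andP[/xyN-> /yzN].
- move=> x y [xy [N xyN]]; split; first exact: lg_eq_opp.
  by exists N => n /xyN /= xyn; rewrite -!opprD xyn.
- move=> x y z t [xy [N xyN]] [zt [N' ztN]]; split; first exact: lg_eq_add.
  exists (maxn N N') => n; rewrite geq_max => /andP[/xyN xyn /ztN ztn] /=.
  by rewrite addrACA xyn ztn addrACA.
- move=> x y z; split; first by apply: lg_eqW => M v /=; rewrite addrA.
  by exists 0%N => n _ /=; rewrite !addrA.
- move=> x y; split; first by apply: lg_eqW => M v /=; rewrite addrC.
  by exists 0%N => n _ /=; congr (_ + _); rewrite addrC.
- move=> x; split; first by apply: lg_eqW => M v /=; rewrite add0r.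
  by exists 0%N => n _ /=; rewrite !add0r.
- move=> x; split; first by apply: lg_eqW => M v /=; rewrite addNr.
  by exists 0%N => n _ /=; rewrite !addNr.
Defined.

Definition lext_mid : zmodType := pg_quot lext_pregroup.
Definition lext_class (x : C * term lgen) : lext_mid := @pg_class lext_pregroup x.

Definition lext_in (a : C) : lext_mid := lext_class (a, TZero _).

Lemma lext_in_additive : zmod_morphism lext_in.
Proof.
move=> x y; rewrite /lext_in /lext_class -pg_classN -pg_classD.
apply/pg_classP; split; first by apply: lg_eqW => M v /=; rewrite subr0.
by exists 0%N => n _ /=; rewrite subr0.
Qed.

HB.instance Definition _ :=
  GRing.isZmodMorphism.Build C lext_mid lext_in lext_in_additive.

Lemma lext_in_inj : injective lext_in.
Proof.
by move=> x y /(@pg_classP lext_pregroup)[_ [N /(_ _ (leqnn N))]] /=; rewrite !addr0.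
Qed.

Lemma lext_out_ex : exists f : {additive lext_mid -> ladder_group},
  forall x, f (lext_class x) = lclass x.2.
Proof.
apply: (@quot_lift_ex lext_pregroup ladder_group (fun x => lclass x.2)).
  by move=> x y [xy _]; apply/lclassP.
by move=> x y /=; rewrite lclass_eval /= -!lclass_eval.
Qed.

(** Eventually constant sequences form a subgroup containing all relators of the truncated
    solutions, so [lg_eq] can be tested on it. This gives exactness in the middle. *)
Lemma lclass0_eventually t : lclass t = 0 ->
  exists a N0, forall N, (N0 <= N)%N -> teval (trunc_sol N) t = a.
Proof.
move=> /lclass_eq0 t0.
pose P (f : nat -> C) := exists a N0, forall N, (N0 <= N)%N -> f N = a.
have [||a [N0 aN]] := t0 (nat -> C) P (fun g N => trunc_sol N g).
- split; first by exists 0, 0%N.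
  move=> f g [a [N fa]] [a' [N' ga]]; exists (a - a'), (maxn N N') => n.
  by rewrite geq_max => /andP[/fa fn /ga gn]; rewrite -fn -gn.
- move=> d n _; exists (c d n), n.+1 => N nN.
  by rewrite -(relator_trunc_sol d nN) -!teval_relterm teval_fct.
- exists a, N0 => N /aN <-; rewrite -[RHS]/(teval _ t N - 0) subr0.
  by rewrite teval_fct.
Qed.

(** A splitting gives a retraction of the middle group onto [C]; it carries the generators, which
    solve the system in the middle group, to a solution in [C]. *)
Lemma solution_of_Ext_vanishes : Ext_vanishes ladder_group C ->
  exists v : lgen -> C, forall d n, A d -> relator v d n = c d n.
Proof.
move=> /Ext_vanishesP ext0; have [out outE] := lext_out_ex.
have out_surj y : exists x, out x = y.
  exists (lext_class (0, pg_repr y)); rewrite outE /=.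
  exact: (@pg_reprK ladder_pregroup).
have exact x : out x = 0 <-> exists a, lext_in a = x.
  split=> [|[a <-]]; last by rewrite outE.
  rewrite -[x](@pg_reprK lext_pregroup); case: (pg_repr x) => a t.
  rewrite -[pg_class _]/(lext_class _) outE /= => t0.
  have [a' [N0 aN]] := lclass0_eventually t0.
  exists (a + a'); apply/(@pg_classP lext_pregroup); split.
    by apply: lg_eq_sym; apply/lclass_eq0.
  by exists N0 => N /aN <- /=; rewrite addr0.
pose E := @Extension ladder_group C lext_mid lext_in out lext_in_inj out_surj exact.
have [f [fin _]] := ext0 E.
exists (fun g => (f (lext_class (0, TGen g))).1) => d n Ad.
pose r : lext_mid -> C := fst \o f.
have rB : zmod_morphism r by move=> x y; rewrite /r /= raddfB.
pose rA := GRing.isZmodMorphism.Build _ _ r rB.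
pose ra : {additive lext_mid -> C} := HB.pack r rA.
have -> : c d n = ra (lext_in (c d n)) by rewrite /= /r /= (fin (c d n)).
rewrite -[LHS](raddf_relator ra); congr (ra _).
have lE t : teval (fun g => lext_class (0, TGen g)) t = lext_class (0, t).
  elim: t => //= [t ->|t -> u ->].
    rewrite /lext_class -pg_classN; apply/pg_classP; split; first exact: lg_eqW.
    by exists 0%N => n' _ /=; rewrite oppr0.
  rewrite /lext_class -pg_classD; apply/pg_classP; split; first exact: lg_eqW.
  by exists 0%N => n' _ /=; rewrite addr0.
rewrite -teval_relterm lE; apply/(@pg_classP lext_pregroup).
split; first exact: lg_eq_relterm.
exists n.+1 => N nN; rewrite add0r addr0 -(relator_trunc_sol d nN).
by rewrite -teval_relterm.
Qed.

End TruncatedSolution.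

Lemma Ext_vanishes_ladderP (C : zmodType) :
  Ext_vanishes ladder_group C <-> solvable_in C.
Proof.
split=> [ext0 c|]; first exact: solution_of_Ext_vanishes.
exact: Ext_vanishes_of_solvable.
Qed.

End LadderGroup.

(** * Solvable and unsolvable systems *)

Lemma no_dyadic_third (y : nat -> int) :
  ~ (forall n, y n.+1 *+ 2 - y n = (~~ odd n)%:R).
Proof.
(* Two consecutive equations give [u k = 4 u (k+1)], so [u 0] is divisible by every power of 4, yet
   it is nonzero modulo 3. *)
move=> yE; pose u k : int := y k.*2 *+ 3 - 1.
have u4 k : u k = u k.+1 *+ 4.
  have := yE k.*2; have := yE k.*2.+1; rewrite /= odd_double /= /u doubleS; lia.
have uX k : `|u 0|%N = (4 ^ k * `|u k|)%N.
  elim: k => [|k ->]; first by rewrite mul1n.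
  by rewrite expnSr -mulnA u4; congr muln; lia.
have u0 : (0 < `|u 0|)%N by rewrite /u /=; lia.
move: u0 (uX `|u 0|%N) (ltn_expl `|u 0|%N (isT : 1 < 4)%N).
by move: `|u 0|%N => m; case: `|u m|%N => [|k]; nia.
Qed.

Lemma backward_solution (x f : nat -> int) (N : nat) :
  (forall n, (N <= n)%N -> x n = - f n) ->
  exists2 y : nat -> int, forall n, y n.+1 *+ 2 - y n - x n = f n &
    (forall n, x n = 0) -> (forall n, f n = 0) -> forall n, y n = 0.
Proof.
(* Here [z k] is the value of [y] at [N - k]: zero from [N] on, where [x] cancels [f], then solved
   downwards without any division by 2. *)
move=> xN; pose fix z k : int :=
  if k is k'.+1 then z k' *+ 2 - x (N - k)%N - f (N - k)%N else 0.
exists (fun n => z (N - n)%N) => [n|x0 f0 n].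
  have [Nn|nN] := leqP N n.
    have -> : (N - n.+1 = 0)%N by lia.
    have -> : (N - n = 0)%N by lia.
    by rewrite /= xN // mul0rn subr0 sub0r opprK.
  have -> : (N - n = (N - n.+1).+1)%N by lia.
  rewrite /= (_ : N - (N - n.+1).+1 = n)%N; last by lia.
  by lia.
by elim: (N - n)%N => //= k ->; rewrite x0 f0; lia.
Qed.

(** * Test groups built from formal solutions, and their evaluation in Z *)

Section TestGroup.
Variables (K : eqType) (lt : rel K) (b : K -> nat -> K).
Hypotheses (lt_irr : irreflexive lt) (lt_trans : transitive lt).
Hypothesis lt_total : forall u v, [|| lt u v, u == v | lt v u].

Lemma ladder_neq d d' : ladder lt d (b d) -> ladder lt d' (b d') -> d != d' ->
  exists j, b d j <> b d' j.
Proof.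
wlog dd' : d d' / lt d d' => [H dl dl' nd|dl dl' _].
  have := lt_total d d'; rewrite (negPf nd) /= => /orP[] /H; first exact.
  rewrite eq_sym => /(_ dl' dl nd)[j jE]; exists j; exact: nesym.
have [j jE] := dl'.2 _ dd'; exists j => bE.
by move: jE; rewrite -bE dl.1.
Qed.

Lemma mkseq_neq (f g : nat -> K) j n : f j <> g j -> (j < n)%N ->
  mkseq f n <> mkseq g n.
Proof.
move=> fg jn /(congr1 (fun s => nth (f j) s j)).
by rewrite !nth_mkseq.
Qed.

Definition gen_below d (g : lgen K) : bool :=
  match g with inl s => all (lt^~ d) s | inr (d', _) => lt d' d end.

Variable B : K -> Prop.
Hypothesis B_ladder : forall d, B d -> ladder lt d (b d).

(** Each of the finitely many earlier ladders differs from that of [e p] at some index, so all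
    longer initial words differ. Likewise, if [d0] is below [e p], long words of its ladder contain
    a point not below [d0]. *)
Lemma countable_thresholds (e : nat -> K) (d0 : K) (p : nat) :
  B (e p) -> (forall q, (q < p)%N -> e q != e p) ->
  exists N, (forall q, (q < p)%N -> B (e q) ->
      forall n, (N <= n)%N -> mkseq (b (e p)) n <> mkseq (b (e q)) n) /\
    (lt d0 (e p) -> forall n, (N <= n)%N -> ~~ all (lt^~ d0) (mkseq (b (e p)) n)).
Proof.
move=> Bp pfirst.
have thr r : (r <= p)%N -> exists N, forall q, (q < r)%N -> B (e q) ->
    forall n, (N <= n)%N -> mkseq (b (e p)) n <> mkseq (b (e q)) n.
  elim: r => [|r IHr rp]; first by exists 0%N.
  have [N NP] := IHr (ltnW rp).
  have [Br|NBr] := pselect (B (e r)); last first.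
    exists N => q; rewrite ltnS leq_eqVlt => /predU1P[-> /NBr//|]; exact: NP.
  have [|j jE] := ladder_neq (B_ladder Bp) (B_ladder Br).
    by rewrite eq_sym pfirst.
  exists (maxn N j.+1) => q; rewrite ltnS leq_eqVlt => /predU1P[->|qr] Bq n;
      rewrite geq_max => /andP[Nn jn]; last exact: NP.
  exact: mkseq_neq jE jn.
have [N1 N1P] := thr p (leqnn p).
have [dp|ndp] := boolP (lt d0 (e p)); last by exists N1.
have [j jE] := (B_ladder Bp).2 _ dp.
exists (maxn N1 j.+1); split=> [q qp Bq n|_ n]; rewrite geq_max => /andP[Nn jn].
  exact: N1P.
apply/allPn; exists (b (e p) j) => //; apply/mapP; exists j => //.
by rewrite mem_iota.
Qed.

(* The words [mkseq (b (e p)) n] with n beyond a threshold depending on p are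
   pairwise distinct, so the x-values on them can absorb f independently. *)
Lemma countable_solution (e : nat -> K) (d0 : K) (f : K -> nat -> int) :
  ~ B d0 ->
  exists v : lgen K -> int,
    (forall p n, B (e p) -> relator b v (e p) n = f (e p) n) /\
    ((forall d n, lt d d0 -> f d n = 0) -> forall g, gen_below d0 g -> v g = 0).
Proof.
move=> NB0.
(* Keeping only the first index of each value makes the ladders of distinct active indices
   distinct. *)
pose active p := B (e p) /\ forall q, (q < p)%N -> e q != e p.
have thr p : exists N, active p -> (forall q, (q < p)%N -> B (e q) ->
      forall n, (N <= n)%N -> mkseq (b (e p)) n <> mkseq (b (e q)) n) /\
    (lt d0 (e p) -> forall n, (N <= n)%N -> ~~ all (lt^~ d0) (mkseq (b (e p)) n)).
  have [[Bp pf]|] := pselect (active p); last by exists 0%N.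
  by have [N NP] := countable_thresholds d0 Bp pf; exists N.
have {thr}[N NP] := choice thr.
have first p : B (e p) -> exists2 q, active q & e q = e p.
  move=> Bp; have ex : exists q, e q == e p by exists p.
  case: (ex_minnP ex) => q /eqP qp qmin; exists q => //; split=> [|r rq].
    by rewrite qp.
  by apply/negP; rewrite qp => /qmin; lia.
(* A hit is a word past the threshold on the ladder of [e p]; its x-value will be chosen to cancel
   [f] there. *)
pose hit s p := [/\ active p, (N p <= size s)%N & s = mkseq (b (e p)) (size s)].
have hit_uniq s p q : hit s p -> hit s q -> p = q.
  wlog pq : p q / (p < q)%N => [H hp hq|[[Bp _] _ sp] [aq Nq sq]].
    by have [pq|qp|//] := ltngtP p q; [apply: H | apply/esym/H].
  by have [/(_ p pq Bp _ Nq)] := NP q aq; rewrite -sp -sq.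
have gx s : exists x : int, (forall p, hit s p -> x = - f (e p) (size s)) /\
    ((forall p, ~ hit s p) -> x = 0).
  have [[p hp]|/forallNP nh] := pselect (exists p, hit s p).
    by exists (- f (e p) (size s)); split=> [q /(hit_uniq _ _ _ hp)->//|/(_ p)].
  by exists 0; split=> // p /nh.
have {gx}[x xP] := choice gx.
have x0 : (forall d n, lt d d0 -> f d n = 0) ->
    forall s, all (lt^~ d0) s -> x s = 0.
  move=> f0 s sd.
  have [[p hp]|/forallNP] := pselect (exists p, hit s p); last exact: (xP s).2.
  rewrite ((xP s).1 p hp); case: hp => ap Np sE.
  (* Below [d0] the right-hand side vanishes, [d0] itself is outside [B], and above [d0] the
     threshold keeps hits from lying entirely below [d0]. *)
  have /or3P[/f0->|/eqP pd|dp] := lt_total (e p) d0; first by rewrite oppr0.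
    by case: NB0; rewrite -pd; case: ap.
  by have /negP[] := (NP p ap).2 dp _ Np; rewrite -sE.
have gy d : exists y : nat -> int, (forall p, active p -> e p = d ->
      forall n, y n.+1 *+ 2 - y n - x (mkseq (b d) n) = f d n) /\
    ((forall d n, lt d d0 -> f d n = 0) -> lt d d0 -> forall n, y n = 0).
  have [[p [ap pd]]|/forallNP np] :=
    pselect (exists p, active p /\ e p = d); last first.
    by exists (fun=> 0); split=> // p ap pd; case: (np p).
  have [|y yE y0] := @backward_solution (fun n => x (mkseq (b d) n)) (f d) (N p).
    move=> n Nn; rewrite ((xP _).1 p) ?size_mkseq ?pd //.
    by split; rewrite ?size_mkseq ?pd.
  exists y; split=> // f0 dd0; apply: y0 => n; last exact: f0.
  apply: x0 => //; apply/allP => _ /mapP[j _ ->].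
  by apply: lt_trans dd0; apply: (B_ladder _).1; rewrite -pd; case: ap.
have {gy}[y yP] := choice gy.
exists (fun g => match g with inl s => x s | inr (d, n) => y d n end).
split=> [p n /first[q aq qp]|f0 [s|[d n]] /=]; [| exact: x0 |
  by move=> dd0; apply: (yP d).2].
by rewrite -qp; apply: ((yP (e q)).1 q).
Qed.

(* [CSol g c] is the value at g of the formal solution of the system with
   right-hand side c. *)
Inductive cterm : Type :=
| CGen of K & nat
| CZero
| COpp of cterm
| CAdd of cterm & cterm
| CSol of lgen K & (K -> nat -> cterm).

Definition admissible (l : seq K) (v : cterm -> int) :=
  [/\ v CZero = 0, forall t, v (COpp t) = - v t,
      forall t u, v (CAdd t u) = v t + v u &
      forall d n c, d \in l -> B d ->
        relator b (fun g => v (CSol g c)) d n = v (c d n)].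

(* Testing in Z only, but with finitely many of the relations at a time, keeps
   the identities finitary. *)
Definition cterm_eq t u :=
  exists l, forall v, admissible l v -> v t = v u.

Lemma admissible_cat l l' v :
  admissible (l ++ l') v -> admissible l v /\ admissible l' v.
Proof.
by move=> [v0 vN vD vS]; split; split=> // d n c dl; apply: vS;
  rewrite mem_cat dl ?orbT.
Qed.

Definition cterm_pregroup : pregroup.
Proof.
refine (@Pregroup cterm CZero COpp CAdd cterm_eq _ _ _ _ _ _ _ _ _).
- by move=> t; exists [::].
- by move=> t u [l tu]; exists l => v /tu.
- move=> u t w [l tu] [l' uw].
  by exists (l ++ l') => v /admissible_cat[/tu-> /uw].
- by move=> t u [l tu]; exists l => v vl; have [_ vN _ _] := vl; rewrite !vN tu.
- move=> t u t' u' [l tu] [l' tu']; exists (l ++ l') => v vl.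
  have [_ _ vD _] := vl; have [/tu vt /tu' vt'] := admissible_cat vl.
  by rewrite !vD vt vt'.
- by move=> t u w; exists [::] => v [_ _ vD _]; rewrite !vD addrA.
- by move=> t u; exists [::] => v [_ _ vD _]; rewrite !vD addrC.
- by move=> t; exists [::] => v [v0 _ vD _]; rewrite vD v0 add0r.
- by move=> t; exists [::] => v [v0 vN vD _]; rewrite vD vN v0 addNr.
Defined.

Definition cgroup : zmodType := pg_quot cterm_pregroup.
Definition cclass (t : cterm) : cgroup := @pg_class cterm_pregroup t.

Definition crelator (w : lgen K -> cterm) d n : cterm :=
  CAdd (CAdd (CAdd (w (inr (d, n.+1))) (w (inr (d, n.+1))))
             (COpp (w (inr (d, n)))))
       (COpp (w (inl (mkseq (b d) n)))).

Lemma cclassD t u : cclass (CAdd t u) = cclass t + cclass u.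
Proof. exact: (@pg_classD cterm_pregroup). Qed.

Lemma cclassN t : cclass (COpp t) = - cclass t.
Proof. exact: (@pg_classN cterm_pregroup). Qed.

Lemma relator_cclass w d n :
  relator b (fun g => cclass (w g)) d n = cclass (crelator w d n).
Proof. by rewrite /crelator !cclassD !cclassN /relator mulr2n. Qed.

Lemma admissible_crelator l v w d n : admissible l v ->
  v (crelator w d n) = relator b (v \o w) d n.
Proof. by move=> [_ vN vD _]; rewrite /crelator !vD !vN /relator mulr2n. Qed.

Lemma cgroup_solvable : solvable_in b B cgroup.
Proof.
move=> c; pose c' d n : cterm := @pg_repr cterm_pregroup (c d n).
exists (fun g => cclass (CSol g c')) => d n Bd; rewrite relator_cclass.
rewrite -[RHS](@pg_reprK cterm_pregroup); apply/(@pg_classP cterm_pregroup).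
exists [:: d] => v vl; rewrite (admissible_crelator _ _ _ vl).
by have [_ _ _] := vl; apply; rewrite ?inE.
Qed.

(* The right-hand sides c are only inspected below d0. *)
Fixpoint hull d0 (t : cterm) : Prop :=
  match t with
  | CGen d _ => lt d d0
  | CZero => True
  | COpp t => hull d0 t
  | CAdd t u => hull d0 t /\ hull d0 u
  | CSol g c => gen_below d0 g /\ forall d n, lt d d0 -> hull d0 (c d n)
  end.

Lemma gen_below_closure (x0 : K) g :
  exists h : nat -> K, forall d, (forall k, lt (h k) d) -> gen_below d g.
Proof.
case: g => [s|[d n]]; last by exists (fun=> d) => d' /(_ 0%N).
by exists (nth x0 s) => d sd; apply/(all_nthP x0).
Qed.

(** This turns the hull condition into closure under a single function, the form that stationarity
    can meet. *)
Lemma hull_closure (x0 : K) t :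
  exists h, forall d, closed_under lt h d -> hull d t.
Proof.
elim: t => [d n||//|t [h hP] u [h' hP']|g c IHc].
- by exists (fun _ _ => d) => d' /(_ 0%N [::]); apply.
- by exists (fun _ _ => x0).
- pose H k s := if unpickle k is Some (e, k') then
      (if e : bool then h else h') k' s else x0.
  exists H => d dH; split; [apply: hP | apply: hP'] => k s sd.
    by have := dH (pickle (true, k)) s sd; rewrite /H pickleK.
  by have := dH (pickle (false, k)) s sd; rewrite /H pickleK.
- have [hg hgP] := gen_below_closure x0 g.
  have [hc hcP] := choice (fun dn => IHc dn.1 dn.2).
  (* The head of the sequence is the index in [K] of a branch of [c], so closure at [d] controls
     exactly the branches below [d]; the empty sequence serves [hg]. *)
  pose H k s := if s is d :: s' then
      if unpickle k is Some (n, k') then hc (d, n) k' s' else x0 else hg k.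
  exists H => d dH; split; first by apply: hgP => k; apply: (dH k [::]).
  move=> d' n dd'; apply: (hcP (d', n)) => k s sd.
  have := dH (pickle (n, k)) (d' :: s); rewrite /H pickleK /=; apply.
  by rewrite dd'.
Qed.

Lemma hull_closure_family (x0 : K) (w : seq K -> cterm) :
  exists h, forall d, closed_under lt h d ->
    forall s, all (lt^~ d) s -> hull d (w s).
Proof.
have [h hP] := choice (fun s => hull_closure x0 (w s)).
(* The word [s] is passed as a prefix of the argument, and the number records its length. *)
pose H k u :=
  if unpickle k is Some (j, k') then h (take j u) k' (drop j u) else x0.
exists H => d dH s sd; apply: hP => k u ud.
have := dH (pickle (size s, k)) (s ++ u); rewrite /H pickleK.
by rewrite take_size_cat ?drop_size_cat // all_cat sd; apply.
Qed.

Section Evaluation.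
Variables (d0 : K) (sol : (K -> nat -> int) -> lgen K -> int).

Fixpoint ceval (t : cterm) : int :=
  match t with
  | CGen d n => if d == d0 then (~~ odd n)%:R else 0
  | CZero => 0
  | COpp t => - ceval t
  | CAdd t u => ceval t + ceval u
  | CSol g c => sol (fun d n => ceval (c d n)) g
  end.

Lemma ceval_hull :
  (forall f, (forall d n, lt d d0 -> f d n = 0) ->
    forall g, gen_below d0 g -> sol f g = 0) ->
  forall t, hull d0 t -> ceval t = 0.
Proof.
move=> sol0; elim=> [d n|//|t IHt|t IHt u IHu|g c IHc] /=.
- by case: eqP => // ->; rewrite lt_irr.
- by move=> /IHt->; rewrite oppr0.
- by move=> [/IHt-> /IHu->]; rewrite addr0.
- by move=> [gd0 cd0]; apply: sol0 => // d n /cd0 /IHc.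
Qed.
End Evaluation.

Variable S : K -> Prop.
Hypothesis S_ladder : forall d, S d -> ladder lt d (b d).
Hypothesis S_stationary : stationary lt S.
Hypothesis BS : forall d, B d -> ~ S d.

Lemma cgroup_not_solvable (x0 : K) : ~ solvable_in b S cgroup.
Proof.
move=> /(_ (fun d n => cclass (CGen d n)))[v vE].
pose w g : cterm := @pg_repr cterm_pregroup (v g).
have vw : v = fun g => cclass (w g).
  by apply/funext => g; rewrite -[LHS](@pg_reprK cterm_pregroup).
have [h hP] := hull_closure_family x0 (fun s => w (inl s)).
have [d0 Sd0 /hP hull_w] := S_stationary h.
have /choice[l lP] n : exists l, forall a, admissible l a ->
    a (crelator w d0 n) = a (CGen d0 n).
  have := vE d0 n Sd0; rewrite vw relator_cclass.
  by move=> /(@pg_classP cterm_pregroup).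
(* This enumerates the members of all the finite lists [l n], so that one evaluation is admissible
   for every [n] at once. *)
pose e p := if unpickle p is Some (n, i) then nth x0 (l n) i else x0.
have eP n d : d \in l n -> exists p, e p = d.
  move=> dl; exists (pickle (n, index d (l n))).
  by rewrite /e pickleK nth_index.
have NBd0 : ~ B d0 by move=> /BS.
have [sol solP] := choice (fun f => countable_solution e f NBd0).
have adm n : admissible (l n) (ceval d0 sol).
  split=> // d m c /eP[p <-] Bp; exact: (solP _).1.
apply: (@no_dyadic_third (fun n => ceval d0 sol (w (inr (d0, n))))) => n.
have := lP n _ (adm n).
rewrite (admissible_crelator _ _ _ (adm n)) /= eqxx => <-.
rewrite /relator /= [ceval d0 sol (w (inl _))](_ : _ = 0) ?subr0 //.
apply: ceval_hull; first by move=> f; have [] := solP f.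
by apply: hull_w; apply/allP => _ /mapP[j _ ->]; apply: (S_ladder Sd0).1.
Qed.

End TestGroup.

(** * Theories generated by families, and the embedding of the power set *)

Section GeneratedTheory.
Variables (J : Type) (F : J -> zmodType) (D : J -> Prop).

Definition generated_right : group_class :=
  fun X => forall j, D j -> Ext_vanishes (F j) X.

Lemma generated_rightP X :
  generated_right X <-> perp_right (perp_left generated_right) X.
Proof.
split=> [DX G GP|XP j Dj]; first exact: GP.
by apply: XP => C; apply.
Qed.

Definition generated_theory : cotorsion_theory :=
  @CotorsionTheory (perp_left generated_right) generated_right
    generated_rightP (fun=> iff_refl _).

End GeneratedTheory.

Lemma Ext_independent_family (I : Type) : exists F C : I -> zmodType,
  forall i j, Ext_vanishes (F i) (C j) <-> i <> j.
Proof.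
have [K [x0 [lt [b [S [irr tr tot [lad disj stat]]]]]]] :=
  disjoint_stationary I.
pose B j d := exists2 i, i <> j & S i d.
have B_ladder j d : B j d -> ladder lt d (b d) by move=> [i _ /lad].
exists (fun i => ladder_group b (S i)), (fun j => cgroup b (B j)) => i j.
rewrite Ext_vanishes_ladderP; split=> [sol ij|ij c].
  rewrite {}ij in sol.
  apply: (@cgroup_not_solvable _ _ _ irr tr tot _ (B_ladder j) (S j)) sol => //.
  - exact: lad.
  - by move=> d [k kj Sk] /(disj _ _ _ Sk).
have [v vE] := cgroup_solvable c; exists v => d n Sd.
by apply: vE; exists i.
Qed.

Theorem theorem3p1 (I : Type) :
  exists Psi : set I -> cotorsion_theory,
    injective Psi /\
    (forall X Y : set I, X `<=` Y <-> ct_le (Psi X) (Psi Y)).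
Proof.
have [F [C FC]] := Ext_independent_family I.
pose Psi (X : set I) := generated_theory F (~` X).
have PsiP X Y : X `<=` Y <-> ct_le (Psi X) (Psi Y).
  split=> [XY G GX i /= nYi|XY i Xi].
    by apply: GX => Xi; apply: nYi; apply: XY.
  apply: contrapT => nYi.
  (* The group [C i] separates the theories: it lies in the right class of [Psi X] since [i] is in
     [X], whereas lying in that of [Psi Y] would make Ext(F i, C i) vanish. *)
  have /XY/(_ i nYi)/FC// : ct_right (Psi X) (C i).
  by move=> j nXj; apply/FC => ji; rewrite ji in nXj.
exists Psi; split=> // X Y XY.
by apply/seteqP; split; apply/PsiP; rewrite XY => G.
Qed.
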